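(* Let $(X_n)_{n\ge0}$ be simple random walk on $\mathbf{\Gamma}$ or on $\Gamma_\circ$, with any choice of $X_0$. Let $D_t$ be the depth of $X_{2t}$. Then almost surely $$\liminf_{t\to\infty}\frac{D_t}{t}\ge\frac16,$$ and for all integers $t\ge12$, $$\mathbf{P}[D_t\le D_0+1]\le e^{-t/1152}.$$
   Context: $\mathbb{Z}_2$ denotes the dyadic ($2$-adic) integers. $\mathbf{\Gamma}$ is the graph on $\mathbb{Z}\times\mathbb{Z}_2$ with edges between $(m,b)$ and $(m,b\pm1)$ and between $(m,b)$ and $(m+1,2b)$; the depth of $(m,b)$ is $m$. (A vertex $(m,b)$ has degree $4$ if $b$ is even and $3$ if $b$ is odd.) $\Gamma_{\circ}$ is the (multi)graph on all finite binary strings, including the empty string $\varnothing$, with edges between $w$ and $w\pm1$ (addition modulo $2^n$ for strings of length $n$, last digit being the units digit) and between $w$ and $w\oplus 0$ ($0$ appended to $w$). At depth $1$ the vertices $0$ and $1$ are joined by two edges, and $\varnothing$ has two loops, each contributing $1$ to its degree. The depth of a string is its length. Simple random walk on $\Gamma_\circ$ picks uniformly from: add $1$; subtract $1$; append $0$; and, if the string ends in $0$, remove that terminal $0$ (from $\varnothing$: stay put in either of two ways, or append $0$). *)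

(* Defs.v *)
From HB Require Import structures.
From mathcomp Require Import all_boot all_order all_algebra.
From mathcomp Require Import all_classical all_reals all_analysis.

Set Implicit Arguments.
Unset Strict Implicit.
Unset Printing Implicit Defensive.

Import Order.TTheory GRing.Theory Num.Theory.

Local Open Scope classical_set_scope.
Local Open Scope ring_scope.

(* The inverse limit of the rings Z/2^n: [z2res x n] is the representative in
   [0, 2^n) of x modulo 2^n.  The coherence condition also forces this range. *)
Record Z2 := MkZ2 {
  z2res :> nat -> int;
  z2resP : forall n, z2res n = (z2res n.+1 %% 2 ^+ n)%Z
}.

HB.instance Definition _ := gen_eqMixin Z2.
HB.instance Definition _ := gen_choiceMixin Z2.

Lemma z2_ext (x y : Z2) : (forall n, x n = y n) -> x = y.
Proof.
case: x y => [x xP] [y yP] /= /funext exy; subst y.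
by rewrite (Prop_irrelevance xP yP).
Qed.

Lemma z2_mod (x : Z2) n : (x n %% 2 ^+ n)%Z = x n.
Proof. by rewrite z2resP modz_mod. Qed.

Lemma modz_pow2S (a : int) n :
  ((a %% 2 ^+ n.+1)%Z %% 2 ^+ n)%Z = (a %% 2 ^+ n)%Z.
Proof.
by rewrite {2}(divz_eq a (2 ^+ n.+1)) exprS mulrA modzMDl.
Qed.

Lemma z2_of_subproof (f : nat -> int) :
  (forall n, (f n.+1 = f n %[mod 2 ^+ n])%Z) ->
  forall n, (f n %% 2 ^+ n)%Z =
    ((f n.+1 %% 2 ^+ n.+1)%Z %% 2 ^+ n)%Z.
Proof. by move=> fP n; rewrite modz_pow2S fP. Qed.

Definition z2_of (f : nat -> int)
    (fP : forall n, (f n.+1 = f n %[mod 2 ^+ n])%Z) : Z2 :=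
  @MkZ2 (fun n => (f n %% 2 ^+ n)%Z) (z2_of_subproof fP).

Lemma z2_congr (x : Z2) n : (x n.+1 = x n %[mod 2 ^+ n])%Z.
Proof. by rewrite -z2resP z2_mod. Qed.

Lemma z2_const_subproof (a : int) n : (a = a %[mod 2 ^+ n])%Z.
Proof. by []. Qed.

Lemma z2_opp_subproof (x : Z2) n : (- x n.+1 = - x n %[mod 2 ^+ n])%Z.
Proof. by rewrite -modzNm z2_congr modzNm. Qed.

Lemma z2_add_subproof (x y : Z2) n :
  (x n.+1 + y n.+1 = x n + y n %[mod 2 ^+ n])%Z.
Proof. by rewrite -modzDm !z2_congr modzDm. Qed.

Lemma z2_mul_subproof (x y : Z2) n :
  (x n.+1 * y n.+1 = x n * y n %[mod 2 ^+ n])%Z.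
Proof. by rewrite -modzMm !z2_congr modzMm. Qed.

Definition z2_const (a : int) : Z2 := z2_of (z2_const_subproof a).
Definition z2_opp (x : Z2) : Z2 := z2_of (z2_opp_subproof x).
Definition z2_add (x y : Z2) : Z2 := z2_of (z2_add_subproof x y).
Definition z2_mul (x y : Z2) : Z2 := z2_of (z2_mul_subproof x y).

Fact z2_addA : associative z2_add.
Proof. by move=> x y z; apply: z2_ext => n /=; rewrite modzDml modzDmr addrA. Qed.

Fact z2_addC : commutative z2_add.
Proof. by move=> x y; apply: z2_ext => n /=; rewrite addrC. Qed.

Fact z2_add0 : left_id (z2_const 0) z2_add.
Proof. by move=> x; apply: z2_ext => n /=; rewrite mod0z add0r z2_mod. Qed.

Fact z2_addN : left_inverse (z2_const 0) z2_opp z2_add.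
Proof. by move=> x; apply: z2_ext => n /=; rewrite modzDml addNr. Qed.

HB.instance Definition _ :=
  GRing.isZmodule.Build Z2 z2_addA z2_addC z2_add0 z2_addN.

Fact z2_mulA : associative z2_mul.
Proof. by move=> x y z; apply: z2_ext => n /=; rewrite modzMml modzMmr mulrA. Qed.

Fact z2_mulC : commutative z2_mul.
Proof. by move=> x y; apply: z2_ext => n /=; rewrite mulrC. Qed.

Fact z2_mul1 : left_id (z2_const 1) z2_mul.
Proof. by move=> x; apply: z2_ext => n /=; rewrite modzMml mul1r z2_mod. Qed.

Fact z2_mulDl : left_distributive z2_mul z2_add.
Proof.
by move=> x y z; apply: z2_ext => n /=; rewrite modzMml modzDm mulrDl.
Qed.

Fact z2_1neq0 : z2_const 1 != 0.
Proof. by apply/eqP => /(congr1 (fun x : Z2 => x 1%N)). Qed.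

HB.instance Definition _ := GRing.Zmodule_isComNzRing.Build Z2
  z2_mulA z2_mulC z2_mul1 z2_mulDl z2_1neq0.

HB.instance Definition _ := isPointed.Build Z2 0.

(* The residue classes are a countable base of the 2-adic topology, so this is
   the Borel sigma-algebra of Z2. *)
Definition z2_classes : set (set Z2) :=
  [set A | exists n (r : int), A = [set x : Z2 | x n = r]].

Definition z2_display : measure_display.
Proof. exact. Qed.

HB.instance Definition _ := @isMeasurable.Build z2_display Z2
  <<s z2_classes >> (@sigma_algebra0 _ setT z2_classes)
  (@sigma_algebraC _ z2_classes) (@sigma_algebra_bigcup _ setT z2_classes).

Definition discrete_display : measure_display.
Proof. exact. Qed.

(* The discrete sigma-algebra on [int]. *)
HB.instance Definition _ := isPointed.Build int 0.
HB.instance Definition _ := @isMeasurable.Build discrete_display int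
  discrete_measurable discrete_measurable0
  discrete_measurableC discrete_measurableU.

(* Finite binary strings, units digit last, with the discrete sigma-algebra. *)
Definition bitstring := seq bool.
HB.instance Definition _ := Choice.on bitstring.
HB.instance Definition _ := isPointed.Build bitstring [::].
HB.instance Definition _ := @isMeasurable.Build discrete_display bitstring
  discrete_measurable discrete_measurable0
  discrete_measurableC discrete_measurableU.

(* A multigraph on V is given by the function counting the edges from u to v;
   a loop at u counts once in [e u u], hence contributes 1 to the degree.  In
   both graphs below the degrees are finite, and the finitely supported sums
   are then the true ones. *)
Definition multigraph (V : Type) := V -> V -> nat.

Definition degree_into (R : realType) (V : choiceType) (e : multigraph V)
  (u : V) (B : set V) : R := \sum_(v \in B) ((e u v)%:R : R).

Definition srw_kernel (R : realType) (V : choiceType) (e : multigraph V)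
  (u : V) (B : set V) : R := degree_into R e u B / degree_into R e u setT.

(* The sigma-algebra generated by X_0, ..., X_n. *)
Definition history d (T : measurableType d) dV (V : measurableType dV)
    (X : nat -> T -> V) (n : nat) : set (set T) :=
  <<s [set H | exists i (A : set V),
         [/\ (i <= n)%N, measurable A & H = X i @^-1` A] ]>>.

(* [X] is a simple random walk on [e], with arbitrary (possibly random) initial
   vertex: P(X_{n+1} in B | X_0, ..., X_n) = srw_kernel e X_n B almost surely,
   for every measurable set B of vertices. *)
Definition simple_random_walk (R : realType) d (T : measurableType d)
    (P : probability T R) dV (V : measurableType dV) (e : multigraph V)
    (X : nat -> T -> V) : Prop :=
  (forall n, measurable_fun setT (X n)) /\
  (forall n (H : set T) (B : set V), history X n H -> measurable B ->
     P (H `&` X n.+1 @^-1` B) =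
     (\int[P]_(w in H) (srw_kernel R e (X n w) B)%:E)%E).

Definition Gamma_vertex := (int * Z2)%type.

Definition Gamma : multigraph Gamma_vertex := fun u v =>
  [|| v == (u.1, u.2 + 1), v == (u.1, u.2 - 1),
      v == (u.1 + 1, 2 * u.2) | u == (v.1 + 1, 2 * v.2)].

Definition Gamma_depth (u : Gamma_vertex) : int := u.1.

Definition bitstring_val (w : bitstring) : nat :=
  foldl (fun (a : nat) (b : bool) => (a.*2 + b)%N) 0%N w.

Definition is_succ (w v : bitstring) : bool :=
  (size v == size w) &&
  (bitstring_val v == (bitstring_val w).+1 %[mod 2 ^ size w])%N.

(* The four terms count the edges to w+1, to w-1, to w with a 0 appended, and
   to w with a terminal 0 removed.  The first two are both 1 for w = v empty
   (two loops) and for {w, v} = {0, 1} (a double edge). *)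
Definition Gamma_o : multigraph bitstring := fun w v =>
  (is_succ w v + is_succ v w + (v == rcons w false) + (w == rcons v false))%N.

Definition Gamma_o_depth (w : bitstring) : int := (size w)%:Z.

(* Main.v *)
Require Import Defs.
From HB Require Import structures.
From mathcomp Require Import all_boot all_order all_algebra.
From mathcomp Require Import all_classical all_reals all_analysis.
From mathcomp Require Import measurable_realfun.
From mathcomp Require Import ring lra zify.

Set Implicit Arguments.
Unset Strict Implicit.
Unset Printing Implicit Defensive.

Import Order.TTheory GRing.Theory Num.Theory.
Import numFieldNormedType.Exports.

Local Open Scope classical_set_scope.
Local Open Scope ring_scope.

(* Call a vertex even if it has degree 4.  An even vertex has one neighbour one
   level deeper, one a level higher and two odd neighbours on its own level; any
   other vertex has one neighbour deeper, and its other two edges stay on the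
   level.  Hence (8/9)^(D_n - D_0), weighted by 36/37 at the odd vertices,
   shrinks in mean by the factor 99/100 at every step, and Markov's inequality
   gives P[D_n <= D_0 + m] <= (37/36) (9/8)^m (99/100)^n.  Taking m = 1 is the
   tail bound; taking m = t/6 after 2t steps gives a summable bound because
   (9/8) (99/100)^12 < 1, and Borel-Cantelli gives the speed. *)

(** * Parity and halving in the dyadic integers *)

Definition z2_even (x : Z2) : bool := x 1%N == 0.

Lemma z2_evenD1 (x : Z2) : z2_even x -> ~~ z2_even (x + 1).
Proof. by rewrite /z2_even /= expr1 => /eqP ->. Qed.

Lemma z2_evenB1 (x : Z2) : z2_even x -> ~~ z2_even (x - 1).
Proof. by rewrite /z2_even /= !expr1 => /eqP ->. Qed.

Lemma z2_2E (x : Z2) n : (2 * x) n = (2 * x n %% 2 ^+ n)%Z.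
Proof. by rewrite mulr_natl mulr2n /= -mulr2n mulr_natl. Qed.

Lemma z2_even_mul2 (x : Z2) : z2_even (2 * x).
Proof. by rewrite /z2_even z2_2E expr1 mulrC modzMl. Qed.

(** A factor 2 costs one level of precision: a congruence of doubles modulo [2 ^+ n.+1] is one of
    the numbers modulo [2 ^+ n]. *)
Lemma z2_mul2I (x y : Z2) : 2 * x = 2 * y -> x = y.
Proof.
move=> xy; apply: z2_ext => n.
have /eqP := congr1 (fun z : Z2 => z n.+1) xy; rewrite !z2_2E exprS.
rewrite eqz_mod_dvd -mulrBr dvdz_mul2l // -eqz_mod_dvd => /eqP.
by rewrite -!z2resP.
Qed.

Lemma z2_half_subproof (x : Z2) n :
  ((x n.+2 %/ 2)%Z = (x n.+1 %/ 2)%Z %[mod 2 ^+ n])%Z.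
Proof.
rewrite [x n.+1]z2resP {1}(divz_eq (x n.+2) (2 ^+ n.+1)) exprS.
by rewrite mulrA mulrAC divzMDl // modzMDl.
Qed.

(** The residue at level [n] is read off one level up, from [x n.+1]. Odd elements are rounded down,
    which keeps the map total. *)
Definition z2_half (x : Z2) : Z2 := z2_of (z2_half_subproof x).

Lemma z2_halfK (x : Z2) : z2_even x -> 2 * z2_half x = x.
Proof.
move=> x_even; apply: z2_ext => n; rewrite z2_2E /= modzMmr.
(* From [x k.+1] to [x k.+2] a multiple of [2 ^+ k.+1] is added, so evenness spreads from the first
   residue to all. *)
have dvd2 k : (2 %| x k.+1)%Z.
  elim: k => [|k IHk]; first by rewrite (eqP x_even).
  rewrite (divz_eq (x k.+2) (2 ^+ k.+1)) -z2resP exprS.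
  by apply: rpredD => //; rewrite mulrCA dvdz_mulr.
by rewrite mulrC divzK // z2_congr z2_mod.
Qed.

(** * Edges at a vertex of the dyadic graph *)

(** The last neighbour is the source of a deepening edge into [u]: it needs [u.2] even and is unique
    because doubling is injective. *)
Lemma Gamma_nbrs (u : Gamma_vertex) : exists s : seq Gamma_vertex,
  (forall v, Gamma u v = count_mem v s) /\
  s = [:: (u.1, u.2 + 1); (u.1, u.2 - 1); (u.1 + 1, 2 * u.2)]
      ++ (if z2_even u.2 then [:: (u.1 - 1, z2_half u.2)] else [::]).
Proof.
eexists; split; last by []; move=> v.
set s := (_ ++ _).
have us : uniq s.
  (* 1 and -1 agree modulo 2; the residue modulo 4 separates them. *)
  have h1 : u.2 + 1 != u.2 - 1.
    apply/eqP => /addrI /(congr1 (fun x : Z2 => x 2%N)) /=.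
    by rewrite /= !expr2.
  have ne1 : u.1 + 1 != u.1 by rewrite -subr_eq0 addrAC subrr.
  have ne2 : u.1 - 1 != u.1 by rewrite -subr_eq0 addrAC subrr.
  have ne3 : u.1 + 1 != u.1 - 1 by lia.
  rewrite /s cat_uniq /= !inE !xpair_eqE eqxx (negPf h1) ![u.1 == _]eq_sym.
  rewrite (negPf ne1) /=.
  case: ifP => //= _; rewrite !inE !xpair_eqE (negPf ne2) /= orbF.
  by rewrite [u.1 - 1 == _]eq_sym (negPf ne3).
rewrite count_uniq_mem // /Gamma /s mem_cat !inE; congr nat_of_bool.
rewrite -!orbA; do 3 congr (_ || _).
have -> : (u == (v.1 + 1, 2 * v.2)) = z2_even u.2 && (v == (u.1 - 1, z2_half u.2)).
  apply/eqP/andP => [-> /=|[u_even /eqP -> /=]].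
    split; first exact: z2_even_mul2.
    rewrite addrK; case: v => m b /=; rewrite xpair_eqE eqxx /=.
    by apply/eqP; apply: z2_mul2I; rewrite z2_halfK ?z2_even_mul2.
  by rewrite subrK z2_halfK //; case: (u).
by case: ifP; rewrite ?inE.
Qed.

(** The features of the edges that the estimate uses, common to both graphs. Listing neighbours with
    multiplicity covers loops and double edges; the last clause forbids moves between two driftless
    vertices of one level. *)
Definition drifting (V : choiceType) (e : multigraph V) (dep : V -> int)
    (ev : pred V) : Prop :=
  forall u, exists s : seq V,
    [/\ forall v, e u v = count_mem v s,
        [seq dep v - dep u | v <- s] =
          if ev u then [:: 0; 0; 1; -1] else [:: 0; 0; 1] &
        ev u -> forall v, v \in s -> dep v = dep u -> ~~ ev v].

Lemma drifting_Gamma : drifting Gamma Gamma_depth (fun u => z2_even u.2).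
Proof.
move=> u; have [s [es sE]] := Gamma_nbrs u; exists s; split => //.
  rewrite sE /Gamma_depth map_cat /= addrAC !subrr add0r.
  by case: ifP => //= _; rewrite addrAC subrr add0r.
move=> u_even v; rewrite sE u_even /Gamma_depth !inE.
case/or4P => /eqP -> /=.
- by move=> _; exact: z2_evenD1.
- by move=> _; exact: z2_evenB1.
- by move/eqP; rewrite -subr_eq0 addrAC subrr.
- by move/eqP; rewrite -subr_eq0 addrAC subrr.
Qed.

(** * Binary strings as residues modulo powers of two *)

Lemma bitstring_val_rcons w b :
  bitstring_val (rcons w b) = ((bitstring_val w).*2 + b)%N.
Proof. by rewrite /bitstring_val -cats1 foldl_cat. Qed.

Lemma bitstring_val_lt w : (bitstring_val w < 2 ^ size w)%N.
Proof.
elim/last_ind: w => [//|w b IHw]; rewrite bitstring_val_rcons size_rcons expnS.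
by case: b; lia.
Qed.

Lemma bitstring_val_inj v w :
  size v = size w -> bitstring_val v = bitstring_val w -> v = w.
Proof.
elim/last_ind: v w => [|v b IHv] w; first by case: w.
case/lastP: w => [|w c]; rewrite ?size_rcons // => -[vw].
rewrite !bitstring_val_rcons => E.
have bc : b = c by case: b c E => -[]; lia.
by rewrite bc (IHv w) //; case: b c E {bc} => -[]; lia.
Qed.

Fixpoint bits (n a : nat) : bitstring :=
  if n is m.+1 then rcons (bits m a./2) (odd a) else [::].

Lemma size_bits n a : size (bits n a) = n.
Proof. by elim: n a => //= n IHn a; rewrite size_rcons IHn. Qed.

Lemma bitstring_val_bits n a : bitstring_val (bits n a) = (a %% 2 ^ n)%N.
Proof.
elim: n a => [|n IHn] a; first by rewrite modn1.
rewrite /= bitstring_val_rcons IHn expnS.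
set r := (a./2 %% 2 ^ n)%N.
have r_lt : (r < 2 ^ n)%N by rewrite ltn_pmod ?expn_gt0.
have {2}-> : a = (a./2 %/ 2 ^ n * (2 * 2 ^ n) + (r.*2 + odd a))%N.
  rewrite -[LHS]odd_double_half {1}(divn_eq a./2 (2 ^ n)) -/r; lia.
by rewrite modnMDl modn_small //; case: (odd a); lia.
Qed.

Lemma is_succE w v : is_succ w v = (v == bits (size w) (bitstring_val w).+1).
Proof.
rewrite /is_succ; apply/andP/eqP => [[/eqP sv /eqP vw]|->].
  apply: bitstring_val_inj; first by rewrite size_bits.
  by rewrite bitstring_val_bits -vw modn_small // -sv bitstring_val_lt.
by rewrite size_bits bitstring_val_bits modn_mod.
Qed.

(** Subtracting 1 is written as adding [(2 ^ size w).-1], which avoids truncated subtraction at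
    0. *)
Lemma is_predE w v :
  is_succ v w = (v == bits (size w) (bitstring_val w + (2 ^ size w).-1)).
Proof.
rewrite /is_succ.
have E : ((bitstring_val w == (bitstring_val v).+1 %[mod 2 ^ size w]) =
    (bitstring_val v == bitstring_val w + (2 ^ size w).-1 %[mod 2 ^ size w]))%N.
  rewrite -[RHS](eqn_modDr 1) -addnA addn1 [in RHS]addn1 prednK ?expn_gt0 //.
  by rewrite modnDr eq_sym.
apply/andP/eqP => [[/eqP sv]|vE].
  rewrite -sv E => /eqP vw; apply: bitstring_val_inj; first by rewrite size_bits.
  by rewrite bitstring_val_bits -vw modn_small // sv bitstring_val_lt.
have sv : size v = size w by rewrite vE size_bits.
by rewrite sv eqxx E vE bitstring_val_bits modn_mod.
Qed.

(** The default in [last true] makes the empty string odd, as it must be: its degree is 3, from two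
    loops and one edge deeper. *)
Lemma drifting_Gamma_o : drifting Gamma_o Gamma_o_depth (fun w => ~~ last true w).
Proof.
move=> w.
exists [:: bits (size w) (bitstring_val w).+1,
  bits (size w) (bitstring_val w + (2 ^ size w).-1), rcons w false
  & if last true w then [::] else [:: take (size w).-1 w]]; split.
- move=> v; rewrite /Gamma_o is_succE is_predE /= -!addnA.
  rewrite ![v == _]eq_sym; do 3 congr (_ + _)%N.
  case/lastP: w => [|w b]; first by case: v.
  rewrite last_rcons size_rcons -cats1 take_size_cat // cats1.
  by rewrite eqseq_rcons; case: b; rewrite ?andbF //= andbT addn0.
- have incr (n : nat) : n.+1%:Z - n%:Z = 1 by lia.
  have decr (n : nat) : n%:Z - n.+1%:Z = -1 by lia.
  rewrite /= /Gamma_o_depth !size_bits size_rcons subrr incr.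
  case/lastP: w => [|w b] //=; rewrite last_rcons size_rcons /=.
  by case: b => //=; rewrite -cats1 take_size_cat // decr.
- case/lastP: w => // w b; rewrite last_rcons => /negPf -> v.
  rewrite /Gamma_o_depth !inE bitstring_val_rcons addn0 => /or4P[] /eqP ->.
  + by rewrite !size_rcons /= last_rcons /= odd_double.
  (* The string is not empty, so the added [2 ^ n - 1] is odd and flips the last digit. *)
  + rewrite !size_rcons /= last_rcons oddD odd_double /=.
    by move=> _; rewrite -subn1 oddB ?expn_gt0 // expnS oddM.
  + by rewrite !size_rcons => -[]; lia.
  + by rewrite -cats1 size_take size_cat /= => -[]; case: ltnP; lia.
Qed.

(** * Degrees, and integrals over countable partitions *)

(** Edge counts vanish off [s], so the support is finite; the sum over distinct entries regroups
    into a count. *)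
Lemma degree_into_count (R : realType) (V : choiceType) (e : multigraph V)
    (u : V) (s : seq V) (B : set V) :
  (forall v, e u v = count_mem v s) ->
  degree_into R e u B = (count (mem B) s)%:R.
Proof.
move=> es; rewrite /degree_into -[B in LHS]set_mem_set.
rewrite -(@bigfs _ _ _ _ (undup s)) ?undup_uniq //.
  under eq_bigr do rewrite es.
  have /= -> := @big_undup_iterop_count R 0 +%R V s (mem B) (fun=> 1).
  by rewrite -sum1_count natr_sum.
by move=> v _; rewrite mem_undup es => vs; rewrite (count_memPn vs).
Qed.

Lemma measurable_fun_countable_fibers d (T : measurableType d) (I : countType)
    (k : T -> I) d' (U : measurableType d') (g : I -> U) :
  (forall i, measurable (k @^-1` [set i])) ->
  measurable_fun setT (fun w => g (k w)).
Proof.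
move=> mk _ Y _; rewrite setTI.
have -> : (fun w => g (k w)) @^-1` Y =
    \bigcup_(i : I) (if g i \in Y then k @^-1` [set i] else set0).
  apply/seteqP; split => w /=.
    by move=> Yw; exists (k w) => //; rewrite mem_set.
  by case=> i _; case: ifPn => // /set_mem Yi /= ->.
apply: countable_bigcupT_measurable => [|i]; first exact: countableP.
by case: ifP.
Qed.

(** This allows conditioning on a countable label: inequalities on the pieces add up. *)
Lemma le_integral_fibers d (T : measurableType d) (R : realType)
    (mu : {measure set T -> \bar R}) (I : countType) (k : T -> I)
    (f g : T -> \bar R) :
  (forall i, measurable (k @^-1` [set i])) ->
  measurable_fun setT f -> measurable_fun setT g ->
  (forall w, 0 <= f w)%E -> (forall w, 0 <= g w)%E ->
  (forall i, \int[mu]_(w in k @^-1` [set i]) f w <=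
             \int[mu]_(w in k @^-1` [set i]) g w)%E ->
  (\int[mu]_w f w <= \int[mu]_w g w)%E.
Proof.
move=> mk mf mg f0 g0 fg.
(* Fibres are indexed by their codes; numbers that code nothing get the empty set. *)
pose F n := if pickle_inv n is Some i then k @^-1` [set i] else set0.
have mF n : measurable (F n) by rewrite /F; case: pickle_inv.
have FT : setT = \bigcup_n F n.
  apply/seteqP; split => // w _; exists (pickle (k w)) => //.
  by rewrite /F pickleK_inv.
have tF : trivIset setT F.
  move=> m n _ _ [w []]; rewrite /F.
  have := @pickle_invK I m; have := @pickle_invK I n.
  by case: pickle_inv => //= i <-; case: pickle_inv => //= j <- <- ->.
rewrite FT !ge0_integral_bigcup //; try by rewrite -FT.
have ig n : (0 <= \int[mu]_(x in F n) f x)%E.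
  by apply: integral_ge0 => w _; exact: f0.
apply: lee_nneseries => [n _|n _]; first by [].
by rewrite /F; case: pickle_inv => // ; rewrite !integral_set0.
Qed.

(** * One step of the walk, conditioned on the past *)

Section kernel_step.
Context d (T : measurableType d) (R : realType) (P : probability T R).
Context dV (V : measurableType dV) (e : multigraph V) (X : nat -> T -> V).
Hypothesis srwX : simple_random_walk P e X.

Lemma measurable_history n S : history X n S -> measurable S.
Proof.
apply: smallest_sub; first exact: sigma_algebra_measurable.
move=> _ [i [A [_ mA ->]]]; rewrite -[_ @^-1` _]setTI.
exact: srwX.1.
Qed.

Lemma historyI n S S' : history X n S -> history X n S' -> history X n (S `&` S').
Proof.
set G := [set H | exists i (A : set V),
  [/\ (i <= n)%N, measurable A & H = X i @^-1` A]].
exact: (@measurableI _ (g_sigma_algebraType G)).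
Qed.

Lemma history_preimage n i A :
  (i <= n)%N -> measurable A -> history X n (X i @^-1` A).
Proof. by move=> le_in mA; apply: sub_sigma_algebra; exists i, A. Qed.

Lemma srw_const n S B p : history X n S -> measurable B ->
  (forall w, S w -> srw_kernel R e (X n w) B = p) ->
  P (S `&` X n.+1 @^-1` B) = (p%:E * P S)%E.
Proof.
move=> hS mB Sp; rewrite srwX.2 //.
rewrite -integral_cst; last exact: measurable_history hS.
by apply: eq_integral => w /set_mem Sw; rewrite Sp.
Qed.

(* Only sets on which the kernel is constant in the current vertex enter, so its
   measurability as a function of that vertex is not an issue. *)
Lemma srw_cells n S (k : nat) (B : nat -> set V) (p c : nat -> R) (h : T -> R) :
  history X n S ->
  (forall i, measurable (B i)) -> (forall i, 0 <= c i) ->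
  (forall i w, (i < k)%N -> S w -> srw_kernel R e (X n w) (B i) = p i) ->
  (forall w, S w ->
    srw_kernel R e (X n w) (~` \big[setU/set0]_(i < k) B i) = 0) ->
  measurable_fun setT h -> (forall w, 0 <= h w) ->
  (forall i w, (i < k)%N -> S w -> B i (X n.+1 w) -> h w <= c i) ->
  (\int[P]_(w in S) (h w)%:E <= (\sum_(i < k) c i * p i)%:E * P S)%E.
Proof.
move=> hS mB c0 SB SN mh h0 hc.
have mS := measurable_history hS.
have mXB i : measurable (X n.+1 @^-1` B i).
  by rewrite -[_ @^-1` _]setTI; exact: srwX.1.
(* [g] charges [c i] for each cell that the next vertex enters, and so bounds [h] almost everywhere
   on [S]. *)
pose g w := (\sum_(i < k) ((c i)%:E * (\1_(X n.+1 @^-1` B i) w)%:E))%E.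
have mg i : measurable_fun S (fun w => (c i)%:E * (\1_(X n.+1 @^-1` B i) w)%:E)%E.
  apply: measurable_funeM; apply/measurable_EFinP.
  exact: measurable_indic.
have g0 i w : (0 <= (c i)%:E * (\1_(X n.+1 @^-1` B i) w)%:E)%E.
  by rewrite mule_ge0 ?lee_fin.
apply: (@le_trans _ _ (\int[P]_(w in S) g w)%E); last first.
  rewrite ge0_integral_sum // -[P S]fineK ?fin_num_measure // -EFinM.
  rewrite mulr_suml -sumEFin.
  apply: lee_sum => i _; rewrite ge0_integralZl //; last 2 first.
  - by apply/measurable_EFinP; exact: measurable_indic.
  - by rewrite lee_fin.
  rewrite integral_indic // setIC.
  rewrite [X in (_ * X)%E](srw_const hS (mB i) (fun w => SB i w (ltn_ord i))).
  by rewrite -[P S]fineK ?fin_num_measure // -!EFinM mulrA.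
apply: ae_ge0_le_integral => //.
- by move=> w _; rewrite lee_fin.
- by apply/measurable_EFinP; apply: measurable_funS mh.
- by move=> w _; rewrite /g sume_ge0.
- exact: emeasurable_sum.
(* The bound can fail only where the next vertex misses every cell, a null event by [SN]. *)
exists (S `&` X n.+1 @^-1` (~` \big[setU/set0]_(i < k) B i)); split.
- apply: measurableI => //; rewrite -[_ @^-1` _]setTI; apply: srwX.1 => //.
  by apply: measurableC; exact: bigsetU_measurable.
- apply: etrans (mul0e _); apply: srw_const SN => //.
  by apply: measurableC; exact: bigsetU_measurable.
move=> w /= /not_implyP[Sw hg]; split => // .
rewrite -bigcup_mkord => -[i /= ik Bi]; apply: hg.
rewrite /g (bigD1 (Ordinal ik)) //= indicE mem_set // mule1.
rewrite (le_trans (_ : _ <= (c i)%:E)%E) ?lee_fin ?(hc i) //.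
by rewrite leeDl // sume_ge0.
Qed.

End kernel_step.

(** * The contracting potential and the tail of the depth *)

Section drift.
Context d (T : measurableType d) (R : realType) (P : probability T R).
Context dV (V : measurableType dV) (e : multigraph V) (X : nat -> T -> V).
Context (dep : V -> int) (ev : pred V).
Hypothesis srwX : simple_random_walk P e X.
Hypothesis drift_e : drifting e dep ev.
Hypothesis mdep : forall j, measurable (dep @^-1` [set j]).
Hypothesis mev : measurable [set v | ev v].

(** Targets are sorted by depth change. The parity clause fixes the weight reached when an even
    vertex is left along its level. *)
Definition cell (j : int) (b : bool) (i : nat) : set V :=
  [set v | dep v = j + nth 0 [:: 0; 1; -1] i /\ (i = 0%N -> b -> ~~ ev v)].

Definition cell_prob (b : bool) (i : nat) : R :=
  nth 0 (if b then [:: 1 / 2; 1 / 4; 1 / 4] else [:: 2 / 3; 1 / 3; 0]) i.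

Lemma measurable_cell j b i : measurable (cell j b i).
Proof.
have -> : cell j b i = dep @^-1` [set j + nth 0 [:: 0; 1; -1] i] `&`
    (if (i == 0%N) && b then ~` [set v | ev v] else setT).
  apply/seteqP; split => v [/= vj vb]; split=> //.
    by case: ifP => // /andP[/eqP i0 /(vb i0) /negP].
  by move=> /eqP i0 b1; apply/negP; rewrite i0 b1 in vb.
apply: measurableI; first exact: mdep.
by case: ifP => // _; exact: measurableC.
Qed.

Lemma srw_kernel_cell u i : (i < 3)%N ->
  srw_kernel R e u (cell (dep u) (ev u) i) = cell_prob (ev u) i.
Proof.
move=> i3; have [s [es sE sev]] := drift_e u.
rewrite /srw_kernel !(degree_into_count _ _ es) /cell_prob.
have -> : count (mem [set: V]) s = size s.
  by rewrite -(@eq_in_count _ predT) ?count_predT // => v _; rewrite /= in_setT.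
rewrite -(size_map (fun v => dep v - dep u)) sE.
have -> : count (mem (cell (dep u) (ev u) i)) s =
    count (pred1 (nth 0 [:: 0; 1; -1] i)) [seq dep v - dep u | v <- s].
  rewrite count_map; apply: eq_in_count => v vs /=.
  apply/idP/eqP => [/set_mem[-> _]|vi]; first by rewrite addrAC subrr add0r.
  apply/mem_set; split; first by rewrite -vi addrC subrK.
  move=> i0 u_ev; apply: sev => //; apply/eqP.
  by rewrite -subr_eq0 vi i0.
rewrite sE; case: i i3 => [|[|[|//]]] _; case: ev => /=; lra.
Qed.

Lemma srw_kernel_cells u :
  srw_kernel R e u (~` \big[setU/set0]_(i < 3) cell (dep u) (ev u) i) = 0.
Proof.
have [s [es sE sev]] := drift_e u.
rewrite /srw_kernel !(degree_into_count _ _ es).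
rewrite (_ : count _ s = 0%N) ?mul0r //; apply/eqP.
rewrite -leqn0 leqNgt -has_count.
apply/hasPn => v vs; apply/negP => /set_mem; apply.
have : dep v - dep u \in [:: 0; 0; 1; -1].
  have := map_f (fun v => dep v - dep u) vs; rewrite sE.
  by case: ev => //; rewrite !inE => /or3P[] ->; rewrite ?orbT.
have vE : dep v = dep u + (dep v - dep u) by rewrite addrC subrK.
rewrite -bigcup_mkord !inE orbA orbb => /or3P[] /eqP Ev; rewrite Ev in vE.
- by exists 0%N => //; split=> // _ u_ev; apply: sev; rewrite // vE addr0.
- by exists 1%N.
- by exists 2%N.
Qed.

(** At an even vertex the mean depth change is 0, and the power of 8/9 alone would grow in mean by
    the factor 1/2 + 145/288. The lower weight of the odd vertices, which have the drift, pays for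
    this. *)
Definition weight (b : bool) : R := if b then 1 else 36 / 37.

Lemma weight_ge0 b : 0 <= weight b.
Proof. by case: b => /=; lra. Qed.

Lemma weight_le1 b : weight b <= 1.
Proof. by case: b => /=; lra. Qed.

(** The argument is initial depth, current depth and parity: countably many values, with the initial
    depth included because [X 0] may be random. *)
Definition potential (l : int * int * bool) : R :=
  (8 / 9) ^ (l.1.2 - l.1.1) * weight l.2.

Definition label n w := (dep (X 0%N w), dep (X n w), ev (X n w)).

Lemma potential_ge0 l : 0 <= potential l.
Proof. by apply: mulr_ge0; [apply: exprz_ge0; lra|exact: weight_ge0]. Qed.

Lemma history_label n l : history X n (label n @^-1` [set l]).
Proof.
case: l => -[k j] b.
have -> : label n @^-1` [set (k, j, b)] =
    X 0%N @^-1` (dep @^-1` [set k]) `&`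
    X n @^-1` (dep @^-1` [set j] `&` (if b then id else setC) [set v | ev v]).
  apply/seteqP; split => w /=.
    by case=> <- <- <-; split => //; split => //; case: ifPn => // /negP.
  case=> <- [<-]; rewrite /label.
  case: b => /=; first by move=> ->.
  by move=> /negP/negPf ->.
apply: historyI; apply: history_preimage => //; apply: measurableI => //.
by case: b => //; exact: measurableC.
Qed.

Lemma measurable_label_fiber n l : measurable (label n @^-1` [set l]).
Proof. exact: (measurable_history srwX (@history_label n l)). Qed.

Lemma measurable_potential n :
  measurable_fun setT (fun w => potential (label n w)).
Proof. exact: measurable_fun_countable_fibers (measurable_label_fiber n). Qed.

Lemma potential_step n l :
  (\int[P]_(w in label n @^-1` [set l]) (potential (label n.+1 w))%:E <=
   \int[P]_(w in label n @^-1` [set l]) ((99 / 100) * potential (label n w))%:E)%E.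
Proof.
case: l => -[k j] b; set S := _ @^-1` _.
have mS : measurable S := measurable_label_fiber _ _.
have SE w : S w -> [/\ dep (X 0%N w) = k, dep (X n w) = j & ev (X n w) = b] by case.
rewrite [leRHS](_ : _ = (99 / 100 * potential (k, j, b))%:E * P S)%E; last first.
  rewrite -integral_cst //; apply: eq_integral => w /set_mem.
  by rewrite /S /= => ->.
set Q : R := (8 / 9) ^ (j - k).
have Q0 : 0 <= Q by apply: exprz_ge0; lra.
(* Along the level an even vertex leads to weight 36/37, and an odd one to weight at most 1. When
   the level changes, the new weight is bounded by 1. *)
pose c i := Q * nth 0 [:: weight (~~ b); 8 / 9; 9 / 8] i.
have c0 i : 0 <= c i.
  apply: mulr_ge0 => //; case: i => [|[|[|i]]] /=; rewrite ?nth_nil //. try lra.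
  exact: weight_ge0.
apply: (le_trans (srw_cells srwX (k := 3) (c := c) (p := cell_prob b)
   (@history_label n (k, j, b)) (measurable_cell j b) c0 _ _
   (measurable_potential n.+1) _ _)) => //.
- by move=> i w i3 /SE[_ <- <-]; exact: srw_kernel_cell.
- by move=> w /SE[_ <- <-]; exact: srw_kernel_cells.
- by move=> w; exact: potential_ge0.
- move=> i w i3 /SE[w0 _ _] [/= wj wb].
  rewrite /potential /= w0 wj addrAC expfzDr ?gt_eqF //.
  rewrite -/Q /c -mulrA ler_wpM2l //.
  case: i i3 wb {wj} => [|[|[|//]]] _ wb /=; last 2 first.
  + by rewrite expr1z ler_piMr ?weight_le1 //; lra.
  + by rewrite exprN1 invf_div ler_piMr ?weight_le1 //; lra.
  rewrite expr0z mul1r; move: wb; case: (b) => [/(_ erefl erefl) /negPf -> //|_].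
  exact: weight_le1.
(* Up to the factor [Q] this is 18/37 + 145/288 <= 99/100 at even and 26/27 <= (99/100)(36/37) at
   odd vertices. *)
- rewrite lee_wpmul2r // lee_fin /potential /= -/Q.
  rewrite !big_ord_recr big_ord0 /= /c /cell_prob /weight.
  by case: (b) => /=; nra.
Qed.

Lemma potential_mean n :
  (\int[P]_w (potential (label n w))%:E <= ((99 / 100) ^+ n)%:E)%E.
Proof.
have pos m w : (0 <= (potential (label m w))%:E)%E by rewrite lee_fin potential_ge0.
have mp m : measurable_fun setT (fun w => (potential (label m w))%:E).
  by apply/measurable_EFinP; exact: measurable_potential.
elim: n => [|n IHn].
  rewrite expr0 -(mul1e 1%:E) -(@probability_setT _ _ _ P) -integral_cst //.
  apply: ge0_le_integral => //.
  move=> w _; rewrite /= probability_setT lee_fin /potential /= subrr expr0z mul1r.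
  exact: weight_le1.
apply: (@le_trans _ _ (\int[P]_w ((99 / 100) * potential (label n w))%:E)%E).
  apply: (le_integral_fibers (measurable_label_fiber n)) => //.
  - by apply/measurable_EFinP; apply: measurable_funM => //;
      exact: measurable_potential.
  - by move=> w; rewrite lee_fin mulr_ge0 ?potential_ge0 //; lra.
  - exact: potential_step.
under eq_integral do rewrite EFinM.
rewrite ge0_integralZl //.
rewrite exprS [leRHS]EFinM lee_wpmul2l //.
Qed.

Lemma measurable_depth_le n (m : int) :
  measurable [set w | dep (X n w) <= dep (X 0%N w) + m].
Proof.
pose f (l : int * int * bool) : bool := l.1.2 <= l.1.1 + m.
have /(_ measurableT [set true]) := @measurable_fun_countable_fibers
  _ _ _ _ _ _ f (measurable_label_fiber n).
by rewrite setTI; apply.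
Qed.

Lemma depth_tail n (m : nat) :
  (P [set w | (dep (X n w) <= dep (X 0%N w) + m%:Z)%R] <=
   (37 / 36 * (9 / 8) ^+ m * (99 / 100) ^+ n)%:E)%E.
Proof.
set E := [set w | _]; have mE : measurable E := measurable_depth_le n m%:Z.
(* A lower bound for the potential on [E]: depth gain at most [m], and the smaller of the two
   weights. *)
pose c : R := (8 / 9) ^+ m * (36 / 37).
have c_gt0 : 0 < c by apply: mulr_gt0; [apply: exprn_gt0|]; lra.
have : (c%:E * P E <= ((99 / 100) ^+ n)%:E)%E.
  apply: le_trans (potential_mean n).
  rewrite -integral_cst // [leLHS]integral_mkcond.
  apply: ge0_le_integral => //.
  - by move=> w _; rewrite /patch; case: ifP => // _; rewrite lee_fin ltW.
  - by apply/(measurable_restrictT _ _).1.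
  - by apply/measurable_EFinP; exact: measurable_potential.
  move=> w _; rewrite /patch; case: ifPn => [/set_mem wE|_]; last first.
    by rewrite lee_fin potential_ge0.
  rewrite lee_fin /potential /= /c.
  apply: ler_pM; rewrite /weight ?exprn_ge0 //; try lra; last by case: ifP => _; lra.
  have -> : (8 / 9 : R) = (9 / 8)^-1 by rewrite invf_div.
  rewrite exprnP !exprz_inv; apply: ler_weXz2l; first by lra.
  by move: wE; rewrite /E /=; lia.
rewrite -[P E]fineK ?fin_num_measure // -EFinM !lee_fin => cP.
rewrite -(ler_pM2l c_gt0) (le_trans cP) // /c.
rewrite le_eqVlt; apply/orP; left; apply/eqP.
have -> : (9 / 8 : R) = (8 / 9)^-1 by rewrite invf_div.
have q0 : (8 / 9 : R) ^+ m != 0 by rewrite expf_neq0 //; lra.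
by rewrite exprVn; field; exact: q0.
Qed.

End drift.

(** * Numerical bounds and lower limits *)

(** By [1 + x <= expR x] it suffices that the left side is at most 95/96 = 1 - 12/1152 at [t = 12],
    which absorbs the prefactor, and that each further unit of [t] costs (99/100)^2 <= 1151/1152. *)
Lemma geometric_decay (R : realType) (t : nat) : (12 <= t)%N ->
  37 / 36 * (9 / 8) ^+ 1 * (99 / 100) ^+ (2 * t) <= expR (- (t%:R / 1152)) :> R.
Proof.
move=> /subnK; move: (t - 12)%N => s <-.
have eS : expR (- ((s + 12)%:R / 1152)) =
    expR (- (1 / 1152)) ^+ s * expR (- (1 / 96)) :> R.
  by rewrite -expRM_natl -expRD natrD -[_ *+ s]mulr_natr; congr expR; lra.
rewrite eS mulnDr exprD exprM expr1.
have e1 : 1151 / 1152 <= expR (- (1 / 1152)) :> R.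
  by apply: le_trans (expR_ge1Dx _); lra.
have e2 : 95 / 96 <= expR (- (1 / 96)) :> R.
  by apply: le_trans (expR_ge1Dx _); lra.
have e3 : (99 / 100) ^+ 2 ^+ s <= expR (- (1 / 1152)) ^+ s :> R.
  by apply: lerXn2r; rewrite ?nnegrE ?expR_ge0 ?exprn_ge0 //; lra.
have e4 : 37 / 36 * (9 / 8) * (99 / 100) ^+ (2 * 12) <= expR (- (1 / 96)) :> R.
  by apply: le_trans e2; rewrite /=; lra.
rewrite [in leLHS](mulrC (_ ^+ s)) [leLHS]mulrA [leRHS]mulrC.
by apply: ler_pM => //.
Qed.

(** A factor 9/8 arises once in six units of [t], and (9/8)(99/100)^12 <= (2499/2500)^6; the
    remaining [t %% 6] units use (99/100)^2 <= 2499/2500. *)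
Lemma speed_bound (R : realType) (t : nat) :
  37 / 36 * (9 / 8) ^+ (t %/ 6) * (99 / 100) ^+ (2 * t) <=
    37 / 36 * (2499 / 2500) ^+ t :> R.
Proof.
rewrite -mulrA ler_pM2l; last by lra.
rewrite exprM {2 3}(divn_eq t 6); move: (t %/ 6)%N (t %% 6)%N => a b.
rewrite (mulnC a) !(exprD _ (6 * a)) !(exprM _ 6) mulrA -exprMn.
apply: ler_pM; rewrite ?exprn_ge0 //; try lra.
  apply: lerXn2r; rewrite ?nnegrE; lra.
  apply: lerXn2r; rewrite ?nnegrE; lra.
Qed.

Lemma le_limn_einf (R : realType) (u v : (\bar R)^nat) :
  (\forall n \near \oo, (v n <= u n)%E) -> (limn_einf v <= limn_einf u)%E.
Proof.
move=> [N _ vu]; rewrite !limn_einf_lim; apply: lee_lim; try exact: is_cvg_einfs.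
exists N => // n /= Nn; apply/ereal_infP => _ [k /= nk <-].
apply: ge_ereal_inf; exists (v k); first by exists k.
by apply: vu; exact: leq_trans nk.
Qed.

Lemma cvg_cst_div_natr (R : realType) (a : R) :
  (fun t : nat => a / t%:R) @ \oo --> (0 : R).
Proof.
rewrite -cvg_shiftS -[X in _ --> (X : R)](mulr0 a).
by apply: cvgMl_tmp; exact: cvg_harmonic.
Qed.

Lemma limn_einf_speed (R : realType) (D : nat -> int) :
  (\forall t \near \oo, D 0%N + (t %/ 6)%N%:Z < D t) ->
  ((1 / 6)%:E <= limn_einf (fun t : nat => ((D t)%:~R / t%:R : R)%:E))%E.
Proof.
move=> Dt.
have cv : (fun t : nat => (1 / 6 + (D 0%N)%:~R / t%:R : R)%:E) @ \oo -->
    ((1 / 6 : R)%:E).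
  apply: cvg_EFin; first by near=> t.
  rewrite -[X in _ --> (X : R)]addr0.
  by apply: cvgD; [exact: cvg_cst|exact: cvg_cst_div_natr].
rewrite -(cvg_limn_einf_sup cv).1; apply: le_limn_einf.
near=> t.
have t0 : (0 < t)%N by near: t; exact: nbhs_infty_gt.
rewrite lee_fin ler_pdivlMr ?ltr0n // mulrDl divfK ?pnatr_eq0 -?lt0n //.
(* The strict inequality makes up for the rounding in [t %/ 6], since 6 (t %/ 6 + 1) exceeds [t]. *)
have : 6 * D 0%N + t%:Z <= 6 * D t.
  have : D 0%N + (t %/ 6)%N%:Z < D t by near: t.
  by have := divn_eq t 6; have := ltn_pmod t (isT : (0 < 6)%N); lia.
rewrite -(ler_int R) rmorphD !rmorphM /= => h.
lra.
Unshelve. all: by end_near.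
Qed.

Lemma geometric_bound_summable (d : measure_display) (T : measurableType d)
    (R : realType) (mu : {measure set T -> \bar R}) (F : nat -> set T) (c r : R) :
  0 <= c -> 0 < r < 1 -> (forall n, mu (F n) <= (c * r ^+ n)%:E)%E ->
  (\sum_(n <oo) mu (F n) < +oo)%E.
Proof.
move=> c0 /andP[r0 r1] Fr.
apply: (@le_lt_trans _ _ (c / (1 - r))%:E); last exact: ltry.
apply: lime_le; first by apply: is_cvg_nneseries.
apply: nearW => n; apply: (@le_trans _ _ (\sum_(0 <= i < n) (c * r ^+ i)%:E)%E).
  exact: lee_sum.
rewrite sumEFin lee_fin; apply: (@geometric_le_lim R n c r) => //.
by rewrite ger0_norm // ltW.
Qed.

(** * From the tail bound to the speed, for both graphs *)

Section walk_speed.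
Context d (T : measurableType d) (R : realType) (P : probability T R).
Context dV (V : measurableType dV) (e : multigraph V) (X : nat -> T -> V).
Context (dep : V -> int) (ev : pred V).
Hypothesis srwX : simple_random_walk P e X.
Hypothesis drift_e : drifting e dep ev.
Hypothesis mdep : forall j, measurable (dep @^-1` [set j]).
Hypothesis mev : measurable [set v | ev v].

Lemma speed_tail (t : nat) : (12 <= t)%N ->
  (P [set w | (dep (X (2 * t)%N w) <= dep (X (2 * 0)%N w) + 1)%R] <=
    (expR (- (t%:R / 1152)))%:E)%E.
Proof.
move=> t12; apply: le_trans (depth_tail srwX drift_e mdep mev (2 * t) 1) _.
by rewrite lee_fin geometric_decay.
Qed.

Lemma speed_ae : {ae P, forall w,
  ((1 / 6)%:E <= limn_einf
     (fun t : nat => ((dep (X (2 * t)%N w))%:~R / t%:R : R)%:E))%E}.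
Proof.
pose F t := [set w | (dep (X (2 * t)%N w) <= dep (X 0%N w) + (t %/ 6)%N%:Z)%R].
have mF t : measurable (F t) by exact: (measurable_depth_le srwX mdep mev).
(* Off this set, null by Borel-Cantelli, the slow events [F t] stop occurring from some time on. *)
exists (lim_sup_set F); split.
- by apply: bigcap_measurable => // n _; exact: bigcup_measurable.
- apply: lim_sup_set_cvg0 => //.
  apply: (@geometric_bound_summable _ _ _ _ _ (37 / 36) (2499 / 2500)); try lra.
  move=> t; apply: le_trans (depth_tail srwX drift_e mdep mev (2 * t) (t %/ 6)) _.
  by rewrite lee_fin speed_bound.
move=> w /= slow n _; apply: contrapT => Fn; apply: slow.
apply: limn_einf_speed; exists n => // t /= nt.
by rewrite muln0 ltNge; apply/negP => Ft; apply: Fn; exists t.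
Qed.

End walk_speed.

Theorem proposition3p3 (R : realType) (d : measure_display)
    (T : measurableType d) (P : probability T R) :
  (forall X : nat -> T -> Gamma_vertex, simple_random_walk P Gamma X ->
     let D t w := Gamma_depth (X (2 * t)%N w) in
     {ae P, forall w,
        ((1 / 6)%:E <= limn_einf (fun t : nat => ((D t w)%:~R / t%:R : R)%:E))%E} /\
     forall t : nat, (12 <= t)%N ->
       (P [set w | (D t w <= D 0%N w + 1)%R] <= (expR (- (t%:R / 1152)))%:E)%E) /\
  (forall X : nat -> T -> bitstring, simple_random_walk P Gamma_o X ->
     let D t w := Gamma_o_depth (X (2 * t)%N w) in
     {ae P, forall w,
        ((1 / 6)%:E <= limn_einf (fun t : nat => ((D t w)%:~R / t%:R : R)%:E))%E} /\
     forall t : nat, (12 <= t)%N ->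
       (P [set w | (D t w <= D 0%N w + 1)%R] <= (expR (- (t%:R / 1152)))%:E)%E).
Proof.
have mdep j : measurable (Gamma_depth @^-1` [set j]).
  by rewrite -[_ @^-1` _]setTI; apply: measurable_fst.
have mev : measurable [set u : Gamma_vertex | z2_even u.2].
  rewrite -[X in measurable X]setTI.
  apply: (@measurable_snd _ _ _ _ measurableT [set x : Z2 | z2_even x]).
  (* Evenness is the residue class of 0 modulo 2, a generator of the sigma-algebra. *)
  apply: sub_sigma_algebra; exists 1%N, 0.
  by apply/seteqP; split => x /eqP.
split=> X srwX D; split.
- exact: (speed_ae srwX drifting_Gamma).
- by move=> t; exact: (speed_tail srwX drifting_Gamma).
- exact: (speed_ae srwX drifting_Gamma_o).
- by move=> t; exact: (speed_tail srwX drifting_Gamma_o).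
Qed.
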